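(* Let $n\ge3$, $(\mathbb{R}^n,g)$ the pseudo-Euclidean space with $g_{ij}=\delta_{ij}\varepsilon_i$, $\varepsilon_i=\pm1$, and $\xi=\sum_{i=1}^n\alpha_ix_i$ with $\sum_{i=1}^n\varepsilon_i\alpha_i^2=0$ (i.e. $\alpha=\sum\alpha_i\partial_{x_i}$ is a null vector). Let $\varphi(\xi)>0$ and $N(\xi)>0$ be smooth functions on an open set $\Omega\subseteq\mathbb{R}^n$ such that $N\big(\frac{N''}{2}+\frac{\varphi'N'}{\varphi}-(n-2)\frac{N\varphi''}{2\varphi}\big)\ge0$ there. Then the function $$\psi(\xi)=\pm\int\sqrt{N\Big(\frac{N''}{2}+\frac{\varphi'N'}{\varphi}-(n-2)\frac{N\varphi''}{2\varphi}\Big)}\,d\xi+c,\qquad c\in\mathbb{R},$$ satisfies $(n-2)\varphi''N-\varphi N''-2\varphi'N'+\frac{2\varphi}{N}(\psi')^2=0$, and $(\Omega,\bar g,N,\psi)$ with $\bar g=\varepsilon_i\delta_{ij}/\varphi^2$ is an electrostatic system. Moreover, every such space has zero scalar curvature.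
   Context: $'$ denotes $d/d\xi$. Definition (electrostatic system): Let $(M^n,h)$, $n\ge3$, be a semi-Riemannian manifold and $N:M\to\mathbb{R}_{>0}$, $\psi:M\to\mathbb{R}$ smooth. $(M,h,N,\psi)$ is an electrostatic system if $\Delta N=\widehat C^2\frac{|\nabla\psi|^2}{N}$, $\operatorname{div}\big(\frac{\nabla\psi}{N}\big)=0$, and $N\operatorname{Ric}=\nabla^2N-2\frac{\nabla\psi\otimes\nabla\psi}{N}+\frac{2}{(n-1)N}|\nabla\psi|^2h$, with $\widehat C^2=\frac{2(n-2)}{n-1}$ and all operators taken with respect to $h$.
   Formalization: The formal theorem additionally assumes that ψ is smooth; without this the claim fails, since ±∫√(…)dξ need not be twice differentiable where the radicand vanishes (e.g. φ=1, N=1+ξ⁴/12 at ξ=0), while an electrostatic system requires ψ smooth. *)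

(* Defs.v *)
From HB Require Import structures.
From mathcomp Require Import all_boot all_order all_algebra.
From mathcomp Require Import all_classical all_reals all_analysis.
Set Implicit Arguments. Unset Strict Implicit. Unset Printing Implicit Defensive.
Import Order.TTheory GRing.Theory Num.Theory.
Import numFieldNormedType.Exports.
Local Open Scope classical_set_scope.
Local Open Scope ring_scope.

Section Coord.
Variables (R : realType) (n : nat).
Notation V := 'rV[R]_n.

Definition ev (i : 'I_n) : V := delta_mx 0 i.

Definition partial (i : 'I_n) (f : V -> R) : V -> R := fun x => derive f x (ev i).

Fixpoint ipartial (s : seq 'I_n) (f : V -> R) : V -> R :=
  match s with [::] => f | i :: s' => partial i (ipartial s' f) end.

Definition smooth_on (U : set V) (f : V -> R) : Prop :=
  forall (s : seq 'I_n) (x : V), U x ->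
    (forall i, derivable (ipartial s f) x (ev i)) /\ {for x, continuous (ipartial s f)}.

(* A semi-Riemannian metric on the open set U (global chart), given by its
   matrix of components h x i j : smooth, symmetric, nondegenerate. *)
Definition semi_riem_metric (U : set V) (h : V -> 'M[R]_n) : Prop :=
  open U /\
  (forall i j, smooth_on U (fun x => h x i j)) /\
  (forall x, U x -> (h x)^T = h x) /\
  (forall x, U x -> \det (h x) != 0).

Variable h : V -> 'M[R]_n.

Definition hinv (x : V) : 'M[R]_n := invmx (h x).

Definition Gam (k i j : 'I_n) (x : V) : R :=
  2^-1 * \sum_(l < n) hinv x k l *
    (partial i (fun y => h y j l) x + partial j (fun y => h y i l) x
     - partial l (fun y => h y i j) x).

Definition Ric (i j : 'I_n) (x : V) : R :=
  \sum_(k < n) (partial k (Gam k i j) x - partial j (Gam k i k) x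
    + \sum_(l < n) (Gam k k l x * Gam l i j x - Gam k j l x * Gam l i k x)).

Definition scal (x : V) : R := \sum_(i < n) \sum_(j < n) hinv x i j * Ric i j x.

Definition hess (f : V -> R) (i j : 'I_n) (x : V) : R :=
  partial i (partial j f) x - \sum_(k < n) Gam k i j x * partial k f x.

Definition lap (f : V -> R) (x : V) : R :=
  \sum_(i < n) \sum_(j < n) hinv x i j * hess f i j x.

Definition grad (f : V -> R) (i : 'I_n) (x : V) : R :=
  \sum_(j < n) hinv x i j * partial j f x.

Definition gnorm2 (f : V -> R) (x : V) : R :=
  \sum_(i < n) \sum_(j < n) hinv x i j * partial i f x * partial j f x.

Definition divg (X : 'I_n -> V -> R) (x : V) : R :=
  \sum_(i < n) (partial i (X i) x + \sum_(k < n) Gam i i k x * X k x).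

End Coord.

Definition electrostatic (R : realType) (n : nat) (U : set 'rV[R]_n)
  (h : 'rV[R]_n -> 'M[R]_n) (N psi : 'rV[R]_n -> R) : Prop :=
  let C2 : R := 2 * (n - 2)%:R / (n - 1)%:R in
  (3 <= n)%N /\
  semi_riem_metric U h /\ smooth_on U N /\ smooth_on U psi /\
  (forall x, U x -> 0 < N x) /\
  (forall x, U x -> lap h N x = C2 * gnorm2 h psi x / N x) /\
  (forall x, U x -> divg h (fun i y => grad h psi i y / N y) x = 0) /\
  (forall x, U x -> forall i j : 'I_n,
     N x * Ric h i j x =
       hess h N i j x - 2 * (partial i psi x * partial j psi x) / N x
       + 2 / ((n - 1)%:R * N x) * gnorm2 h psi x * h x i j).

Definition smooth1_on (R : realType) (I : set R) (f : R -> R) : Prop :=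
  forall (k : nat) (t : R), I t -> derivable (derive1n k f) t 1.

Definition xi (R : realType) (n : nat) (alpha : 'rV[R]_n) (x : 'rV[R]_n) : R :=
  \sum_(i < n) alpha 0 i * x 0 i.

Definition gbar (R : realType) (n : nat) (eps : 'I_n -> R) (phi : R -> R)
  (alpha : 'rV[R]_n) (x : 'rV[R]_n) : 'M[R]_n :=
  \matrix_(i, j) ((i == j)%:R * eps i / phi (xi alpha x) ^+ 2).

Definition Fexpr (R : realType) (n : nat) (phi N : R -> R) (t : R) : R :=
  N t * (derive1n 2 N t / 2 + derive1 phi t * derive1 N t / phi t
         - (n - 2)%:R * N t * derive1n 2 phi t / (2 * phi t)).

(* Main.v *)
Require Import Defs.
From HB Require Import structures.
From mathcomp Require Import all_boot all_order all_algebra.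
From mathcomp Require Import all_classical all_reals all_analysis.
From mathcomp Require Import ring.
Import Order.TTheory GRing.Theory Num.Theory.
Import numFieldNormedType.Exports.
Local Open Scope classical_set_scope.
Local Open Scope ring_scope.

(* Every function involved is a ridge function f(xi), so partial_i acts as
   alpha_i d/dxi.  With q = phi'/phi the Christoffel symbols of gbar are
     Gamma^k_ij = - q (delta_jk alpha_i + delta_ik alpha_j
                       - delta_ij eps_i eps_k alpha_k),
   and since alpha is null all contractions collapse to multiples of
   alpha_i alpha_j:
     Hess f = (f'' + 2 q f') alpha_i alpha_j,
     Ric    = (n - 2) (q' + q^2) alpha_i alpha_j
            = (n - 2) (phi''/phi) alpha_i alpha_j.
   The gbar-trace of alpha_i alpha_j vanishes, hence so do Laplacians, squared
   gradients, the divergence and the scalar curvature; the Ricci equation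
   reduces to the ODE, which is (psi')^2 = F rearranged. *)

(** * Smoothness of one-variable functions on an open set, and its closure properties *)

Section OneVariable.
Context {R : realType}.
Implicit Types (I : set R) (f g : R -> R) (k : nat).

Lemma derive1nSr k f : derive1n k.+1 f = derive1n k (derive1 f).
Proof. by elim: k => [|k IH] //; rewrite [LHS]derive1nS IH. Qed.

Lemma eq_on_derive1 I f g : open I -> {in I, f =1 g} ->
  {in I, derive1 f =1 derive1 g}.
Proof.
move=> oI fg t; rewrite inE => It; rewrite !derive1E; apply: near_eq_derive.
by near=> u; apply: fg; rewrite inE; near: u; apply: open_nbhs_nbhs.
Unshelve. all: by end_near. Qed.

Lemma eq_on_derivable I f g t : open I -> {in I, f =1 g} -> I t ->
  derivable f t 1 -> derivable g t 1.
Proof.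
move=> oI fg It; apply: near_eq_derivable.
by near=> u; apply: fg; rewrite inE; near: u; apply: open_nbhs_nbhs.
Unshelve. all: by end_near. Qed.

(** [smooth1_on] adds derivatives from the outside. This version peels off [derive1 f] first, so
    that an induction on [k] generalised over [f] can use the sum, product and inverse rules. *)
Fixpoint times_derivable_on I k f : Prop :=
  if k is k'.+1 then
    (forall t, I t -> derivable f t 1) /\ times_derivable_on I k' (derive1 f)
  else True.

Lemma smooth1_onP I f :
  smooth1_on I f <-> forall k, times_derivable_on I k f.
Proof.
split=> [fS k|fS k t It].
  elim: k f fS => //= k IH f fS; split; first exact: (fS 0).
  by apply: IH => j t It; rewrite -derive1nSr; exact: fS.
elim: k f fS => [|k IH] f fS; first by have [/(_ t It)] := fS 1.
by rewrite derive1nSr; apply: IH => j; have [] := fS j.+1.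
Qed.

Lemma times_derivable_onW I k f :
  times_derivable_on I k.+1 f -> times_derivable_on I k f.
Proof.
elim: k f => // k IH f [fd fS]; split => //; exact: IH.
Qed.

(** The rules of differentiation give the derivative of a compound function on [I] only, not as an
    equality of functions. Openness of [I] makes agreement there enough at every order. *)
Lemma eq_times_derivable_on I k f g : open I -> {in I, f =1 g} ->
  times_derivable_on I k f -> times_derivable_on I k g.
Proof.
move=> oI; elim: k f g => //= k IH f g fg [fd fS]; split.
  by move=> t It; apply: (eq_on_derivable _ _ _ _ oI fg It); exact: fd.
exact: IH (eq_on_derive1 _ _ _ oI fg) fS.
Qed.

Lemma times_derivable_onD I k f g : open I -> times_derivable_on I k f ->
  times_derivable_on I k g -> times_derivable_on I k (fun t => f t + g t).
Proof.
move=> oI; elim: k f g => //= k IH f g [fd fS] [gd gS]; split.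
  by move=> t It; apply: derivableD; [exact: fd|exact: gd].
apply: (@eq_times_derivable_on _ _ _ _ oI _ (IH _ _ fS gS)) => t.
rewrite inE => It; rewrite !derive1E deriveD//; [exact: fd|exact: gd].
Qed.

Lemma times_derivable_onN I k f : open I -> times_derivable_on I k f ->
  times_derivable_on I k (fun t => - f t).
Proof.
move=> oI; elim: k f => //= k IH f [fd fS]; split.
  by move=> t It; apply: derivableN; exact: fd.
apply: (@eq_times_derivable_on _ _ _ _ oI _ (IH _ fS)) => t.
rewrite inE => It; rewrite !derive1E deriveN//; exact: fd.
Qed.

Lemma times_derivable_onM I k f g : open I -> times_derivable_on I k f ->
  times_derivable_on I k g -> times_derivable_on I k (fun t => f t * g t).
Proof.
move=> oI; elim: k f g => // k IH f g fS1 gS1.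
(* The derivative f g' + g f' contains f and g themselves, so both are also required at the lower
   order [k]. *)
have [fS gS] := (times_derivable_onW _ _ _ fS1, times_derivable_onW _ _ _ gS1).
case: fS1 gS1 => fd f'S [gd g'S]; split.
  by move=> t It; apply: derivableM; [exact: fd|exact: gd].
apply: (@eq_times_derivable_on _ _ _ _ oI _
  (times_derivable_onD _ _ _ _ oI (IH _ _ fS g'S) (IH _ _ gS f'S))) => t.
rewrite inE => It; rewrite !derive1E deriveM//; [exact: fd|exact: gd].
Qed.

Lemma times_derivable_onV I k f : open I -> (forall t, I t -> f t != 0) ->
  times_derivable_on I k f -> times_derivable_on I k (fun t => (f t)^-1).
Proof.
move=> oI f0; elim: k => // k IH fS1.
(* The derivative of 1/f is - (1/f)(1/f) f', so the induction hypothesis for 1/f at order [k] feeds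
   the product rule. *)
have VS := IH (times_derivable_onW _ _ _ fS1).
case: fS1 => fd f'S; split.
  by move=> t It; apply: derivableV; [exact: f0|exact: fd].
apply: (@eq_times_derivable_on _ _ _ _ oI _ (times_derivable_onN _ _ _ oI
  (times_derivable_onM _ _ _ _ oI
    (times_derivable_onM _ _ _ _ oI VS VS) f'S))) => t.
rewrite inE => It; rewrite !derive1E deriveV ?f0//; last exact: fd.
by rewrite /GRing.scale /= expr2 invfM mulNr.
Qed.

Lemma smooth1_on_invsqr I f : open I -> (forall t, I t -> f t != 0) ->
  smooth1_on I f -> smooth1_on I (fun t => (f t ^+ 2)^-1).
Proof.
move=> oI f0 /smooth1_onP fS; apply/smooth1_onP => k.
apply: times_derivable_onV => // [t It|]; first by rewrite expf_neq0// f0.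
exact: times_derivable_onM.
Qed.

End OneVariable.

(** * Ridge functions f(xi): partial derivatives and smoothness *)

Section Ridge.
Set Implicit Arguments.
Unset Strict Implicit.
Context {R : realType} {n : nat}.
Variable alpha : 'rV[R]_n.

Lemma xi_continuous : continuous (xi alpha).
Proof.
apply: (@continuous_big R _ _ _ _ _ 'rV[R]_n _ (fun i x => alpha 0 i * x 0 i)).
  exact: add_continuous.
move=> i _ x; apply: (@cvgM _ _ (nbhs x)); first exact: cvg_cst.
exact: coord_continuous.
Qed.

Lemma xi_line (x : 'rV[R]_n) i (t : R) :
  xi alpha (t *: ev R i + x) = t * alpha 0 i + xi alpha x.
Proof.
rewrite /xi (eq_bigr (fun j => (j == i)%:R * (t * alpha 0 j) + alpha 0 j * x 0 j)).
  rewrite big_split /= (bigD1 i)//= eqxx mul1r big1 ?addr0//.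
  by move=> j /negbTE->; rewrite mul0r.
by move=> j _; rewrite !mxE eqxx /= mulrDr; ring.
Qed.

(** On the line x + t e_i the map xi is affine in t with slope alpha_i, so the one-variable chain
    rule at t = 0 applies. *)
Lemma is_derive_ridge (f : R -> R) (x : 'rV[R]_n) i :
  derivable f (xi alpha x) 1 ->
  is_derive x (ev R i) (f \o xi alpha) (alpha 0 i * derive1 f (xi alpha x)).
Proof.
move=> fd; set a := alpha 0 i.
have lineE : (fun t : R => (f \o xi alpha) (t *: ev R i + x)) =
    f \o (fun t : R => t * a + xi alpha x).
  by apply/funext => t /=; rewrite xi_line.
have ld : is_derive (0 : R) 1 (fun t : R => t * a + xi alpha x) a.
  have := is_deriveD (is_deriveM (is_derive_id (0 : R) 1)
    (is_derive_cst a (0 : R) 1)) (is_derive_cst (xi alpha x) (0 : R) 1).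
  by move=> /is_derive_eq; apply; rewrite scaler0 add0r addr0 /GRing.scale /= mulr1.
have fd' : is_derive (0 * a + xi alpha x) 1 f (derive1 f (xi alpha x)).
  by rewrite mul0r add0r derive1E; exact: derivableP.
have cd := @is_derive1_comp _ _ (fun t : R => t * a + xi alpha x) _ _ _ fd' ld.
split.
  by apply/derivable1P; rewrite lineE; case: cd.
(* The derivative at x along e_i and the derivative at 0 of the restriction to the line are limits
   of the same difference quotient. *)
rewrite mulrC -[RHS](@derive_val _ _ _ _ _ _ _ cd) -lineE /derive.
congr (lim _); apply: (congr1 (fun g => fmap g _)); apply/funext => t /=.
by rewrite scale0r add0r addr0 [t *: 1]mulr1.
Qed.

Section OpenSet.
Context {I : set R} {U : set 'rV[R]_n}.
Hypotheses (oU : open U) (UI : forall x, U x -> I (xi alpha x)).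

(** Metric components and Christoffel symbols are known as ridge functions on [U] only; [c] holds
    their constant tensor coefficients and the factors alpha_i gathered by repeated
    differentiation. *)
Lemma is_derive_ridge_on (F : 'rV[R]_n -> R) (f : R -> R) (c : R) x i : U x ->
  (forall y, U y -> F y = c * f (xi alpha y)) -> derivable f (xi alpha x) 1 ->
  is_derive x (ev R i) F (c * (alpha 0 i * derive1 f (xi alpha x))).
Proof.
move=> Ux FE fd; have Rd := is_deriveZ c (is_derive_ridge i fd).
have nE : \forall y \near x, (c *: (f \o xi alpha)) y = F y.
  by near=> y; rewrite FE //; near: y; apply: open_nbhs_nbhs.
split.
  by apply: (near_eq_derivable nE); case: Rd.
by rewrite -(near_eq_derive _ nE) derive_val.
Unshelve. all: by end_near. Qed.

Lemma partial_ridge_on (F : 'rV[R]_n -> R) (f : R -> R) (c : R) x i : U x ->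
  (forall y, U y -> F y = c * f (xi alpha y)) -> derivable f (xi alpha x) 1 ->
  partial i F x = c * alpha 0 i * derive1 f (xi alpha x).
Proof.
move=> Ux FE fd; rewrite -mulrA.
by have [_] := is_derive_ridge_on i Ux FE fd.
Qed.

Lemma ipartial_ridge_on (F : 'rV[R]_n -> R) (f : R -> R) (c : R) s :
  smooth1_on I f -> (forall y, U y -> F y = c * f (xi alpha y)) ->
  forall x, U x -> ipartial s F x =
    (c * \prod_(i <- s) alpha 0 i) * derive1n (size s) f (xi alpha x).
Proof.
move=> fS FE; elim: s => [|i s IH] x Ux /=; first by rewrite big_nil mulr1 FE.
rewrite (partial_ridge_on i Ux IH); last by apply: fS; exact: UI.
by rewrite big_cons; ring.
Qed.

Lemma smooth_on_ridge (F : 'rV[R]_n -> R) (f : R -> R) (c : R) :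
  smooth1_on I f -> (forall y, U y -> F y = c * f (xi alpha y)) ->
  smooth_on U F.
Proof.
move=> fS FE s x Ux; have IE := ipartial_ridge_on s fS FE.
have fd : derivable (derive1n (size s) f) (xi alpha x) 1 by apply/fS/UI.
split=> [i|]; first by have [] := is_derive_ridge_on i Ux IE fd.
set G := fun y => c * \prod_(i <- s) alpha 0 i * derive1n (size s) f (xi alpha y).
have nE : \forall y \near x, G y = ipartial s F y.
  by near=> y; rewrite IE //; near: y; apply: open_nbhs_nbhs.
change (ipartial s F @ x --> ipartial s F x).
rewrite (IE x Ux); apply: cvg_trans (near_eq_cvg nE) _.
apply: cvgM; first exact: cvg_cst.
apply: (@continuous_comp _ _ _ (xi alpha) (derive1n (size s) f)).
  exact: xi_continuous.
by apply: differentiable_continuous; apply/derivable1_diffP.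
Unshelve. all: by end_near. Qed.

End OpenSet.
End Ridge.

(** * Algebra of the Christoffel constants for a null vector *)

Section Conformal.
Set Implicit Arguments.
Unset Strict Implicit.
Context {R : realType} {n : nat}.
Variables (eps : 'I_n -> R) (alpha : 'rV[R]_n).
Hypothesis eps2 : forall i, eps i * eps i = 1.
Hypothesis null : \sum_(i < n) eps i * alpha 0 i ^+ 2 = 0.

Local Notation a i := (alpha 0 i).

Lemma sum_delta (F : 'I_n -> R) i : \sum_(k < n) (i == k)%:R * F k = F i.
Proof.
rewrite (bigD1 i)//= eqxx mul1r big1 ?addr0// => k.
by rewrite eq_sym => /negbTE->; rewrite mul0r.
Qed.

(* The Christoffel symbols of eps_i delta_ij / phi^2 are
   - (phi'/phi) * (these constants). *)
Definition chr (k i j : 'I_n) : R :=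
  (j == k)%:R * a i + (i == k)%:R * a j - (i == j)%:R * (eps i * eps k * a k).

(** The first and last terms cancel because eps_k^2 = 1. This holds for each k before any summation,
    so the full trace is n times a_l. *)
Lemma chrkk k l : chr k k l = a l.
Proof.
rewrite /chr eqxx mul1r eps2 mul1r [l == k]eq_sym.
case: eqP => [->|_]; rewrite ?mul1r ?mul0r; ring.
Qed.

Lemma chrC k i j : chr k i j = chr k j i.
Proof.
rewrite /chr [j == i]eq_sym; case: (eqVneq i j) => [->|_]; rewrite ?mul0r; ring.
Qed.

(** [H] is arbitrary so that it can be alpha itself or, for the quadratic terms of the Ricci tensor,
    a row of [chr]. *)
Lemma sum_chr (H : 'I_n -> R) i j : \sum_(k < n) chr k i j * H k =
  a i * H j + a j * H i - (i == j)%:R * eps i * \sum_(k < n) eps k * a k * H k.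
Proof.
rewrite (eq_bigr (fun k => (j == k)%:R * (a i * H k) + (i == k)%:R * (a j * H k)
  - (i == j)%:R * eps i * (eps k * a k * H k))); last first.
  by move=> k _; rewrite /chr; ring.
by rewrite sumrB big_split /= !sum_delta mulr_sumr.
Qed.

Lemma null_sum : \sum_(k < n) eps k * a k * a k = 0.
Proof. by rewrite -[RHS]null; apply: eq_bigr => k _; ring. Qed.

Lemma sum_chr_alpha i j : \sum_(k < n) chr k i j * a k = 2 * (a i * a j).
Proof. by rewrite sum_chr null_sum; ring. Qed.

(** The middle term of [chr] contracts to the null sum; the other two cancel by eps_j^2 = 1. *)
Lemma sum_chr_eps i j :
  \sum_(l < n) eps l * a l * chr i j l = 0.
Proof.
rewrite (eq_bigr (fun l => (i == l)%:R * (eps l * a l * a j)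
  + (j == i)%:R * (eps l * a l * a l)
  - (j == l)%:R * (eps l * eps j * a l * (eps i * a i)))); last first.
  by move=> l _; rewrite /chr [l == i]eq_sym; ring.
by rewrite sumrB big_split /= !sum_delta -mulr_sumr null_sum eps2; ring.
Qed.

Lemma sum_chr_chr i j :
  \sum_(k < n) \sum_(l < n) chr k j l * chr l i k = (n%:R + 2) * (a i * a j).
Proof.
(* The inner sum over l is [sum_chr] applied to a row of [chr], whose last term dies by
   [sum_chr_eps]. Summing over k then yields n copies of a_i a_j plus a simple contraction worth 2
   a_i a_j. *)
rewrite (eq_bigr (fun k => a i * a j + chr k j i * a k)); last first.
  move=> k _; under eq_bigr => l _ do rewrite mulrC.
  by rewrite sum_chr sum_chr_eps chrC chrkk; ring.
rewrite big_split /= sumr_const card_ord sum_chr_alpha -mulr_natl; ring.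
Qed.

Lemma sum_chr_trace i j :
  \sum_(k < n) \sum_(l < n) chr k k l * chr l i j = n%:R * (2 * (a i * a j)).
Proof.
rewrite (eq_bigr (fun=> 2 * (a i * a j))); last first.
  move=> k _; rewrite -sum_chr_alpha; apply: eq_bigr => l _.
  by rewrite chrkk mulrC.
by rewrite sumr_const card_ord -[_ *+ n]mulr_natl.
Qed.

(** * The metric [gbar]: inverse, Christoffel symbols, Ricci and scalar curvature *)

Context {I : set R} {U : set 'rV[R]_n} {phi : R -> R}.
Hypotheses (oI : open I) (oU : open U) (UI : forall x, U x -> I (xi alpha x)).
Hypotheses (phiS : smooth1_on I phi) (phi_gt0 : forall t, I t -> 0 < phi t).

Local Notation h := (gbar eps phi alpha).
Local Notation ph x := (phi (xi alpha x)).

Lemma phi_neq0 t : I t -> phi t != 0.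
Proof. by move=> /phi_gt0; rewrite lt0r => /andP[]. Qed.

Let phx_neq0 x : U x -> ph x != 0.
Proof. by move=> /UI; exact: phi_neq0. Qed.

Lemma gbar_mulV x : U x ->
  h x *m (\matrix_(i, j) ((i == j)%:R * eps i * ph x ^+ 2)) = 1%:M.
Proof.
move=> Ux; apply/matrixP => i j; rewrite !mxE.
rewrite (eq_bigr (fun k => (i == k)%:R * (eps i / ph x ^+ 2 *
  ((k == j)%:R * eps k * ph x ^+ 2)))); last first.
  by move=> k _; rewrite !mxE; ring.
rewrite sum_delta; case: eqP => _; last by rewrite !mul0r mulr0.
by rewrite -[RHS](eps2 i) mul1r; field; exact: phx_neq0.
Qed.

Lemma hinv_gbar x i j : U x -> hinv h x i j = (i == j)%:R * eps i * ph x ^+ 2.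
Proof.
move=> Ux; have hV := gbar_mulV Ux; have [hu _] := mulmx1_unit hV.
by rewrite /hinv -[invmx _]mulmx1 -hV mulKmx// mxE.
Qed.

Lemma sum_hinv (F : 'I_n -> R) x i : U x ->
  \sum_(j < n) hinv h x i j * F j = eps i * ph x ^+ 2 * F i.
Proof.
move=> Ux; rewrite -(sum_delta (fun j => eps i * ph x ^+ 2 * F j)).
by apply: eq_bigr => j _; rewrite hinv_gbar//; ring.
Qed.

Lemma trace_null (F : R) x : U x ->
  \sum_(i < n) \sum_(j < n) hinv h x i j * (F * (a i * a j)) = 0.
Proof.
move=> Ux; rewrite (eq_bigr (fun i => ph x ^+ 2 * F * (eps i * a i * a i))).
  by rewrite -mulr_sumr null_sum mulr0.
by move=> i _; rewrite sum_hinv//; ring.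
Qed.

Lemma gbar_metric : semi_riem_metric U h.
Proof.
split=> //; split=> [i j|].
  apply: (smooth_on_ridge oU UI (f := fun t => (phi t ^+ 2)^-1)
    (c := (i == j)%:R * eps i)); last by move=> y _; rewrite mxE.
  by apply: smooth1_on_invsqr => //; exact: phi_neq0.
split=> x Ux.
  by apply/matrixP => i j; rewrite !mxE eq_sym; case: eqP => [->|]; rewrite ?mul0r.
by have [hu _] := mulmx1_unit (gbar_mulV Ux); rewrite -unitfE -unitmxE.
Qed.

Lemma phi_derivable t : I t -> derivable phi t 1.
Proof. exact: (@phiS 0%N). Qed.

Lemma partial_gbar k i j x : U x -> partial k (fun y => h y i j) x =
  - 2 * (i == j)%:R * eps i * a k * (derive1 phi (xi alpha x) / ph x ^+ 3).
Proof.
move=> Ux; have It := UI Ux; have p0 := phx_neq0 Ux.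
have pd := phi_derivable It.
have pd2 : derivable (fun t => phi t * phi t) (xi alpha x) 1 by exact: derivableM.
rewrite (partial_ridge_on (alpha := alpha) oU (f := fun t => (phi t * phi t)^-1)
    (c := (i == j)%:R * eps i) (x := x))//; last 2 first.
- by move=> y _; rewrite mxE expr2.
- by apply: derivableV => //; rewrite mulf_neq0.
rewrite !derive1E deriveV ?mulf_neq0// [X in _ *: X]deriveM//.
by rewrite /GRing.scale /=; field.
Qed.

(** The function q of the overview. *)
Definition logd (t : R) : R := derive1 phi t / phi t.

Lemma Gam_gbar k i j x : U x ->
  Gam h k i j x = - chr k i j * logd (xi alpha x).
Proof.
move=> Ux; have p0 := phx_neq0 Ux.
(* Inserting eps_l eps_k = 1 into the first two deltas of [chr] matches the sign factors coming from
   the inverse metric and from the differentiated metric. *)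
have de l : (l == k)%:R * eps l * eps k = (l == k)%:R :> R.
  by case: eqP => [->|]; rewrite ?mul0r // mul1r eps2.
rewrite /chr -(de j) -(de i) /Gam sum_hinv// !partial_gbar// /logd.
by field.
Qed.

Lemma logd_derivable t : I t -> derivable logd t 1.
Proof.
move=> It; apply: derivableM; first exact: (@phiS 1%N).
by apply: derivableV; [exact: phi_neq0|exact: phi_derivable].
Qed.

(** This is q' + q^2 = phi''/phi, the identity that turns the Ricci coefficient into a second
    derivative of phi. *)
Lemma derive1_logd t : I t ->
  derive1 logd t = derive1n 2 phi t / phi t - logd t ^+ 2.
Proof.
move=> It; have p0 := phi_neq0 It; have pd := phi_derivable It.
have p'd : derivable (derive1 phi) t 1 by exact: (@phiS 1%N).
have Vd : derivable (fun u => (phi u)^-1) t 1 by exact: derivableV.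
rewrite derive1E [LHS]deriveM// deriveV// -!derive1E /logd.
by rewrite /GRing.scale /=; field.
Qed.

Lemma Ric_gbar i j x : U x -> Ric h i j x =
  (n%:R - 2) * (derive1n 2 phi (xi alpha x) / ph x) * (a i * a j).
Proof.
move=> Ux; have It := UI Ux; set L := logd (xi alpha x).
set L' := derive1 logd (xi alpha x); set D := derive1n 2 phi _.
have pG k u v m : partial m (Gam h k u v) x = - chr k u v * a m * L'.
  rewrite (partial_ridge_on (alpha := alpha) oU
    (f := logd) (c := - chr k u v) _ Ux)//.
    by move=> y; exact: Gam_gbar.
  exact: logd_derivable.
rewrite /Ric (eq_bigr (fun k => - L' * (chr k i j * a k) + a i * a j * L'
  + L ^+ 2 * \sum_(l < n) chr k k l * chr l i j
  - L ^+ 2 * \sum_(l < n) chr k j l * chr l i k)); last first.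
  move=> k _; rewrite !pG [chr k i k]chrC chrkk.
  rewrite (eq_bigr (fun l => L ^+ 2 * (chr k k l * chr l i j)
    - L ^+ 2 * (chr k j l * chr l i k))); last first.
    by move=> l _; rewrite !Gam_gbar// -/L; ring.
  by rewrite sumrB -!mulr_sumr; ring.
(* The coefficient of a_i a_j becomes (n - 2) q' from the differentiated symbols and (2n - (n + 2))
   q^2 from their products. *)
rewrite sumrB !big_split /= -!mulr_sumr sum_chr_alpha sum_chr_trace sum_chr_chr.
rewrite sumr_const card_ord -[_ *+ n]mulr_natl /L' derive1_logd// -/L -/D; ring.
Qed.

Lemma scal_gbar x : U x -> scal h x = 0.
Proof.
move=> Ux; rewrite /scal.
by under eq_bigr do under eq_bigr do rewrite Ric_gbar//; exact: trace_null.
Qed.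

(** * Hessian, Laplacian, gradient and divergence for ridge data on [gbar] *)

Section RidgeFunction.
Context {f : R -> R}.
Hypothesis fS : smooth1_on I f.

Lemma partial_ridge i x : U x ->
  partial i (f \o xi alpha) x = a i * derive1 f (xi alpha x).
Proof.
move=> Ux; rewrite (partial_ridge_on (alpha := alpha) oU (c := 1) (f := f) _ Ux) ?mul1r//.
  by move=> y _ /=; rewrite mul1r.
exact: (@fS 0%N _ (UI Ux)).
Qed.

Lemma smooth_ridge : smooth_on U (f \o xi alpha).
Proof.
by apply: (smooth_on_ridge oU UI fS (c := 1)) => y _ /=; rewrite mul1r.
Qed.

Lemma hess_gbar i j x : U x -> hess h (f \o xi alpha) i j x =
  (derive1n 2 f (xi alpha x) + 2 * logd (xi alpha x) * derive1 f (xi alpha x))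
    * (a i * a j).
Proof.
move=> Ux; rewrite /hess (partial_ridge_on (alpha := alpha) oU (c := a j) (f := derive1 f) _ Ux).
- rewrite (eq_bigr (fun k => - (logd (xi alpha x) * derive1 f (xi alpha x)) *
    (chr k i j * a k))); last first.
    by move=> k _; rewrite Gam_gbar// partial_ridge//; ring.
  rewrite -mulr_sumr sum_chr_alpha /=; ring.
- by move=> y Uy; rewrite partial_ridge.
- exact: (@fS 1%N _ (UI Ux)).
Qed.

Lemma lap_gbar x : U x -> lap h (f \o xi alpha) x = 0.
Proof.
move=> Ux; rewrite /lap.
by under eq_bigr do under eq_bigr do rewrite hess_gbar//; exact: trace_null.
Qed.

Lemma gnorm2_gbar x : U x -> gnorm2 h (f \o xi alpha) x = 0.
Proof.
move=> Ux; rewrite -[RHS](trace_null (derive1 f (xi alpha x) ^+ 2) Ux).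
apply: eq_bigr => i _; apply: eq_bigr => j _.
by rewrite !partial_ridge//; ring.
Qed.

Lemma grad_gbar i x : U x -> grad h (f \o xi alpha) i x =
  eps i * a i * (phi (xi alpha x) ^+ 2 * derive1 f (xi alpha x)).
Proof. by move=> Ux; rewrite /grad sum_hinv// partial_ridge//; ring. Qed.

End RidgeFunction.

(** Both the coordinate divergence w' sum eps_i a_i^2 and the trace term, where Gamma^i_ik = - q
    a_k, are multiples of the null sum. *)
Lemma divg_gbar (w : R -> R) (X : 'I_n -> 'rV[R]_n -> R) x : U x ->
  (forall i y, U y -> X i y = eps i * a i * w (xi alpha y)) ->
  (forall t, I t -> derivable w t 1) -> divg h X x = 0.
Proof.
move=> Ux XE wd; rewrite /divg.
rewrite (eq_bigr (fun i => derive1 w (xi alpha x) * (eps i * a i * a i))).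
  by rewrite -mulr_sumr null_sum mulr0.
move=> i _; rewrite (partial_ridge_on (alpha := alpha) oU _ Ux (XE i)); last exact: wd (UI Ux).
rewrite (eq_bigr (fun k => - logd (xi alpha x) * w (xi alpha x) *
  (eps k * a k * a k))); last first.
  by move=> k _; rewrite Gam_gbar// chrkk XE//; ring.
by rewrite -mulr_sumr null_sum; ring.
Qed.

End Conformal.

(** * The ODE and the electrostatic equations *)

Theorem theorem1p3 (R : realType) (n : nat) (eps : 'I_n -> R) (alpha : 'rV[R]_n)
  (phi N : R -> R) (I : set R) (Omega : set 'rV[R]_n) (s : R) (psi : R -> R) :
  (3 <= n)%N ->
  (forall i, eps i = 1 \/ eps i = -1) ->
  \sum_(i < n) eps i * alpha 0 i ^+ 2 = 0 ->
  open I -> open Omega -> (forall x, Omega x -> I (xi alpha x)) ->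
  smooth1_on I phi -> smooth1_on I N ->
  (forall t, I t -> 0 < phi t) -> (forall t, I t -> 0 < N t) ->
  (forall t, I t -> 0 <= Fexpr n phi N t) ->
  (s = 1 \/ s = -1) ->
  smooth1_on I psi ->
  (forall t, I t -> derive1 psi t = s * Num.sqrt (Fexpr n phi N t)) ->
  (forall t, I t ->
     (n - 2)%:R * derive1n 2 phi t * N t - phi t * derive1n 2 N t - 2 * derive1 phi t * derive1 N t
     + 2 * phi t / N t * (derive1 psi t) ^+ 2 = 0)
  /\ electrostatic Omega (gbar eps phi alpha) (N \o xi alpha) (psi \o xi alpha)
  /\ (forall x, Omega x -> scal (gbar eps phi alpha) x = 0).
Proof.
move=> n3 epsE null oI oU UI phiS NS phi_gt0 N_gt0 F_ge0 sE psiS psi'E.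
have eps2 i : eps i * eps i = 1 by case: (epsE i) => ->; ring.
have p0 t : I t -> phi t != 0 by move=> It; rewrite gt_eqF ?phi_gt0.
have N0 t : I t -> N t != 0 by move=> It; rewrite gt_eqF ?N_gt0.
have n2E : (n - 2)%:R = n%:R - 2 :> R by rewrite natrB// ltnW.
(* Squaring removes the sign [s], and nonnegativity of the radicand removes the square root. *)
have psi2 t : I t -> derive1 psi t ^+ 2 = Fexpr n phi N t.
  move=> It; rewrite psi'E// exprMn sqr_sqrtr ?F_ge0//.
  by case: sE => ->; ring.
have ode t : I t ->
    (n - 2)%:R * derive1n 2 phi t * N t - phi t * derive1n 2 N t
    - 2 * derive1 phi t * derive1 N t
    + 2 * phi t / N t * (derive1 psi t) ^+ 2 = 0.
  by move=> It; rewrite psi2// /Fexpr; field; rewrite p0 ?N0.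
split=> //; split; last first.
  by move=> x Ux; exact: (scal_gbar eps2 null oU UI phiS phi_gt0 Ux).
split=> //; split; first exact: (gbar_metric eps2 oI oU UI phiS phi_gt0).
split; first exact: (smooth_ridge oU UI NS).
split; first exact: (smooth_ridge oU UI psiS).
split; first by move=> x /UI; exact: N_gt0.
have gn0 x : Omega x -> gnorm2 (gbar eps phi alpha) (psi \o xi alpha) x = 0.
  by move=> Ux; exact: (gnorm2_gbar eps2 null oU UI phi_gt0 psiS Ux).
split=> [x Ux|].
  rewrite gn0// mulr0 mul0r.
  exact: (lap_gbar eps2 null oU UI phiS phi_gt0 NS Ux).
split=> [x Ux|x Ux i j].
  (* The gradient of psi is eps_i a_i phi^2 psi', so dividing by N gives the profile w = phi^2
     psi'/N. *)
  apply: (divg_gbar eps2 null oU UI phiS phi_gt0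
    (w := fun t => phi t * phi t * derive1 psi t * (N t)^-1) Ux).
    move=> i y Uy /=.
    rewrite (grad_gbar eps2 oU UI phi_gt0 psiS i Uy); ring.
  move=> t It; apply: derivableM; last first.
    by apply: derivableV; [exact: N0|exact: (NS 0%N)].
  apply: derivableM; last exact: (psiS 1%N).
  by apply: derivableM; exact: (phiS 0%N).
have It := UI _ Ux.
(* The metric term drops out since the gradient of psi is null; every remaining term is a multiple
   of a_i a_j. *)
rewrite gn0// mulr0 mul0r addr0 (Ric_gbar eps2 null oU UI phiS phi_gt0)//.
rewrite (hess_gbar eps2 null oU UI phiS phi_gt0 NS)//.
rewrite !(partial_ridge oU UI psiS)// /logd /=.
have := ode _ It; rewrite n2E /=; move: (p0 _ It) (N0 _ It).
set p := phi _; set N_ := N _; move=> p_neq0 N_neq0 odeE.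
apply/eqP; rewrite -subr_eq0; apply/eqP.
set E := (X in X = 0) in odeE.
(* The difference of the two sides is the left side of the ODE divided by phi, times a_i a_j. *)
transitivity (E / p * (alpha 0 i * alpha 0 j)); last by rewrite odeE !mul0r.
by rewrite /E; field; rewrite p_neq0.
Qed.
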